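(* There exist a $C^*$-algebra $\mathfrak{A}$, a Hilbert $\mathfrak{A}$-module $H$, and adjointable operators $T_1,T_2\in\mathcal{L}(H)$ with $T_1^2=0$ such that $w(T_1)\neq\frac12\|T_1\|$ and $$\sup_{\theta\in[0,2\pi]}\|\mathrm{Re}(e^{i\theta}T_2)\|<w(T_2).$$
   Context: A (right) Hilbert $\mathfrak{A}$-module $H$ is a right $\mathfrak{A}$-module with an $\mathfrak{A}$-valued inner product $\langle\cdot,\cdot\rangle$ (linear in the second variable, conjugate-linear in the first) that is complete in the norm $\|x\|=\sqrt{\|\langle x,x\rangle\|}$. $\mathcal{L}(H)$ is the $C^*$-algebra of all adjointable operators on $H$, with the operator norm. For $T\in\mathcal{L}(H)$, $\mathrm{Re}(T)=\frac12(T+T^* )$, and the numerical radius of $T$ is $w(T)=\sup\{\|\langle Tx,x\rangle\| : x\in H,\ \|x\|=1\}$, where the norm of $\langle Tx,x\rangle$ is the norm of $\mathfrak{A}$. *)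

(* Defs.v *)
From HB Require Import structures.
From mathcomp Require Import all_boot all_order all_algebra complex.
From mathcomp Require Import all_classical all_reals all_analysis.
Set Implicit Arguments.
Unset Strict Implicit.
Unset Printing Implicit Defensive.
Import Order.TTheory GRing.Theory Num.Theory.
Import numFieldNormedType.Exports.
Local Open Scope classical_set_scope.
Local Open Scope complex_scope.
Local Open Scope ring_scope.

(* The norm of a normed module over R[i] takes its values in R[i]; rnorm is
   the same (real) number as an element of R. *)
Definition rnorm (R : realType) (V : normedModType R[i]) (x : V) : R :=
  complex.Re `|x|.

Lemma rnormE (R : realType) (V : normedModType R[i]) (x : V) :
  `|x| = (rnorm x)%:C.
Proof.
rewrite /rnorm; have := normr_ge0 x.
by case: `|x| => a b; rewrite lecE /= => /andP[/eqP-> _].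
Qed.

(* The ring structures of MathComp all have a unit, so the multiplication is
   introduced here: C*-algebras are not assumed to be unital. *)
HB.mixin Record CompleteNormedModule_isCStarAlgebra (R : realType) A
    & CompleteNormedModule R[i] A := {
  cmul : A -> A -> A;
  star : A -> A;
  cmulA : associative cmul;
  cmulDl : left_distributive cmul +%R;
  cmulDr : right_distributive cmul +%R;
  cmulZl : forall (c : R[i]) (a b : A), cmul (c *: a) b = c *: cmul a b;
  cmulZr : forall (c : R[i]) (a b : A), cmul a (c *: b) = c *: cmul a b;
  rnorm_cmul_le : forall a b : A, rnorm (cmul a b) <= rnorm a * rnorm b;
  starK : involutive star;
  starD : {morph star : a b / a + b};
  starZ : forall (c : R[i]) (a : A), star (c *: a) = c^* *: star a;
  starM : forall a b : A, star (cmul a b) = cmul (star b) (star a);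
  rnorm_star_cmul : forall a : A, rnorm (cmul (star a) a) = rnorm a ^+ 2 }.

#[short(type="cstarAlgType")]
HB.structure Definition CStarAlgebra (R : realType) :=
  {A of CompleteNormedModule R[i] A & CompleteNormedModule_isCStarAlgebra R A}.

Definition cpositive (R : realType) (A : cstarAlgType R) (a : A) : Prop :=
  exists b : A, a = cmul (star b) b.

(* Completeness is that of completeNormedModType; rnorm_inner says that the
   norm in question is the one given by the inner product. *)
HB.mixin Record CompleteNormedModule_isHilbertModule (R : realType)
    (A : cstarAlgType R) H & CompleteNormedModule R[i] H := {
  ract : H -> A -> H;
  inner : H -> H -> A;
  ractDl : forall (x y : H) (a : A), ract (x + y) a = ract x a + ract y a;
  ractDr : forall (x : H) (a b : A), ract x (a + b) = ract x a + ract x b;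
  ractM : forall (x : H) (a b : A), ract x (cmul a b) = ract (ract x a) b;
  ractZl : forall (c : R[i]) (x : H) (a : A), ract (c *: x) a = c *: ract x a;
  ractZr : forall (c : R[i]) (x : H) (a : A), ract x (c *: a) = c *: ract x a;
  innerDr : forall x y z : H, inner x (y + z) = inner x y + inner x z;
  innerZr : forall (c : R[i]) (x y : H), inner x (c *: y) = c *: inner x y;
  inner_ract : forall (x y : H) (a : A), inner x (ract y a) = cmul (inner x y) a;
  star_inner : forall x y : H, star (inner x y) = inner y x;
  inner_ge0 : forall x : H, cpositive (inner x x);
  inner_eq0 : forall x : H, inner x x = 0 -> x = 0;
  rnorm_inner : forall x : H, rnorm x = Num.sqrt (rnorm (inner x x)) }.

#[short(type="hilbertModType")]
HB.structure Definition HilbertModule (R : realType) (A : cstarAlgType R) :=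
  {H of CompleteNormedModule R[i] H & CompleteNormedModule_isHilbertModule R A H}.

Section Adjointable.
Variables (R : realType) (A : cstarAlgType R) (H : hilbertModType A).
Implicit Types x y z : H.

(* Linearity, A-linearity and boundedness of opfun all follow from opadjP, and
   opadj is determined by opfun (opadj_unique), so keeping it as data does not
   change the notion. *)
Record adjointable := Adjointable {
  opfun :> H -> H;
  opadj : H -> H;
  opadjP : forall x y, inner (opfun x) y = inner x (opadj y) }.

Implicit Types S T : adjointable.

Lemma innerDl x y z : inner (x + y) z = inner x z + inner y z.
Proof. by rewrite -star_inner innerDr starD !star_inner. Qed.

Lemma innerZl (c : R[i]) x y : inner (c *: x) y = c^* *: inner x y.
Proof. by rewrite -star_inner innerZr starZ star_inner. Qed.

Lemma inner_inj x y : (forall z, inner z x = inner z y) -> x = y.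
Proof.
move=> xy; have xyz z : inner z (x - y) = 0.
  by rewrite -(scaleN1r y) innerDr innerZr xy scaleN1r subrr.
by apply/eqP; rewrite -subr_eq0; apply/eqP/(@inner_eq0 _ _ H)/xyz.
Qed.

Lemma opadj_unique S T : opfun S = opfun T -> opadj S = opadj T.
Proof.
move=> ST; apply/funext => y; apply: inner_inj => z.
by rewrite -!opadjP ST.
Qed.

Fact adjoint_subproof T x y : inner (opadj T x) y = inner x (T y).
Proof. by rewrite -star_inner -opadjP star_inner. Qed.

Definition adjoint T : adjointable := Adjointable (adjoint_subproof T).

Fact opadd_subproof S T x y :
  inner (S x + T x) y = inner x (opadj S y + opadj T y).
Proof. by rewrite innerDl innerDr !opadjP. Qed.

Definition opadd S T : adjointable := Adjointable (opadd_subproof S T).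

Fact opscale_subproof (c : R[i]) T x y :
  inner (c *: T x) y = inner x (c^* *: opadj T y).
Proof. by rewrite innerZl innerZr opadjP. Qed.

Definition opscale (c : R[i]) T : adjointable :=
  Adjointable (opscale_subproof c T).

Definition opRe T : adjointable := opscale (2^-1) (opadd T (adjoint T)).

(* sup is real-valued. The suprema below are over bounded sets, since adjointable
   operators are bounded; the set is empty only for numerical_radius with H = 0,
   where sup set0 = 0. *)
Definition opnorm T : R :=
  sup [set rnorm (T x) | x in [set x : H | rnorm x <= 1]].

Definition numerical_radius T : R :=
  sup [set rnorm (inner (T x) x) | x in [set x : H | rnorm x = 1]].

End Adjointable.

Definition expi (R : realType) (t : R) : R[i] := cos t +i* sin t.

(* Main.v *)
Require Import Defs.
From HB Require Import structures.
From mathcomp Require Import all_boot all_order all_algebra complex.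
From mathcomp Require Import all_classical all_reals all_analysis.
From mathcomp Require Import spectral sesquilinear.
From mathcomp Require Import lra.
Import Order.TTheory GRing.Theory Num.Theory.
Import numFieldNormedType.Exports.
Local Open Scope classical_set_scope.
Local Open Scope complex_scope.
Local Open Scope ring_scope.
Import Normc.

(** A C*-algebra A is a Hilbert module over itself, with <x, y> = x^* y.  If A
    has a unit e, the operator L_a of left multiplication by a satisfies
    <L_a e, e> = a^*, so that its numerical radius is the whole norm of a: the
    classical inequality w(T) <= |T| is always an equality for such operators.
    This is as far from the Hilbert space picture as possible, where an
    operator of square zero has w(T) = |T| / 2 and where w(T) is the supremum
    of the norms of the real parts Re(e^{i theta} T).

    Both failures are witnessed by a single a with a^2 = 0 and
    a a^* + a^* a = e, for instance the matrix unit E_01 of M_2(C).  The first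
    relation makes a^* a a nonzero projection, so |a| = 1 and
    w(L_a) = |L_a| = 1, which is not 1/2.  For |c| = 1 the self-adjoint element
    c a + c^* a^* squares to a a^* + a^* a = e, so it has norm 1; hence every
    Re(c L_a) has norm 1/2, and the supremum over the circle is 1/2 < 1.
    This algebra is in [rnorm_mxunit], [numerical_radius_lmul] and
    [opnorm_Re_mxunit].

    It remains to make M_n(C) a C*-algebra.  Its norm is the operator norm on
    row vectors with the Euclidean norm.  The C*-identity comes from
    |u a|^2 = <u, u a a^*> and the Cauchy-Schwarz inequality
    ([opmxnorm_adj_mul]); completeness holds because the operator norm lies
    between the largest modulus of an entry and the sum of the moduli of all
    entries, so that convergence is convergence of entries
    ([cmatrix_complete]). *)

(** * Complex moduli and real-valued norms *)

Section ComplexModulus.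
Context {R : realType}.
Implicit Types c z : R[i].

Lemma normcE c : `|c| = (normc c)%:C.
Proof. by []. Qed.

Lemma normc_ge0 c : 0 <= normc c.
Proof. by case: c => x y; apply: sqrtr_ge0. Qed.

Lemma normc_real (x : R) : 0 <= x -> normc x%:C = x.
Proof. by move=> x0; rewrite /= expr0n addr0 sqrtr_sqr ger0_norm. Qed.

Lemma Re_ge0M c z : 0 <= c -> complex.Re (c * z) = complex.Re c * complex.Re z.
Proof.
case: c z => [x y] [z t]; rewrite lecE /= => /andP[/eqP-> _].
by rewrite mul0r subr0.
Qed.

Lemma le_Re c z : c <= z -> complex.Re c <= complex.Re z.
Proof. by rewrite lecE => /andP[]. Qed.

Lemma Re_normM c z : complex.Re (`|c| * z) = normc c * complex.Re z.
Proof. by rewrite normcE; case: z => x y /=; rewrite mul0r subr0. Qed.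

Lemma Re_norm_ge0 z : 0 <= z -> normc z = complex.Re z.
Proof. by move=> /ger0_norm <-; rewrite normcE normc_real ?normc_ge0. Qed.

Lemma normc_le_ReIm z : normc z <= `|complex.Re z| + `|complex.Im z|.
Proof.
case: z => x y /=; rewrite -[leRHS]ger0_norm ?addr_ge0 // -sqrtr_sqr.
apply: ler_wsqrtr; rewrite sqrrD !real_normK ?num_real // lerD2r lerDl.
by rewrite mulrn_wge0 ?mulr_ge0.
Qed.

Lemma ReIm_le_normc z :
  `|complex.Re z| <= normc z /\ `|complex.Im z| <= normc z.
Proof.
by case: z => x y /=; rewrite -!sqrtr_sqr !ler_wsqrtr // ?lerDl ?lerDr sqr_ge0.
Qed.

End ComplexModulus.

Section RealNorm.
Context {R : realType} {V : normedModType R[i]}.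
Implicit Types x : V.

Lemma rnorm_ge0 x : 0 <= rnorm x.
Proof. by have := normr_ge0 x; rewrite rnormE ler0c. Qed.

Lemma rnorm_eq0 x : rnorm x = 0 -> x = 0.
Proof. by move=> x0; apply: normr0_eq0; rewrite rnormE x0. Qed.

Lemma rnormZ (c : R[i]) x : rnorm (c *: x) = normc c * rnorm x.
Proof. by rewrite {1}/rnorm normrZ Re_normM. Qed.

End RealNorm.

(** * Norms of special elements of a C*-algebra *)

Section CStarTheory.
Context {R : realType} {A : cstarAlgType R}.
Implicit Types a b e p : A.

Lemma cmul0r a : cmul 0 a = 0.
Proof. by have := cmulZl 0 a a; rewrite !scale0r. Qed.

Lemma cmulr0 a : cmul a 0 = 0.
Proof. by have := cmulZr 0 a a; rewrite !scale0r. Qed.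

Lemma star0 : star (0 : A) = 0.
Proof. by have := starZ 0 (0 : A); rewrite conjC0 !scale0r. Qed.

Lemma star_cmul_eq0 a : cmul (star a) a = 0 -> a = 0.
Proof.
move=> a0; apply/rnorm_eq0/eqP.
by rewrite -sqrf_eq0 -rnorm_star_cmul a0 /rnorm normr0.
Qed.

(** From |b|^2 = |b^* b| <= |b^*| |b| one gets |b| <= |b^*|, and the converse by
    exchanging b and b^*. *)
Lemma rnorm_star a : rnorm (star a) = rnorm a.
Proof.
have le b : rnorm b <= rnorm (star b).
  have [/le_trans->//|b0] := lerP (rnorm b) 0; first exact: rnorm_ge0.
  rewrite -(ler_pM2r b0) -expr2 -rnorm_star_cmul.
  exact: rnorm_cmul_le.
by apply/eqP; rewrite eq_le le andbT -{2}(starK a) le.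
Qed.

(** The C*-identity reads |p| = |p|^2. *)
Lemma rnorm_projection p : star p = p -> cmul p p = p -> p <> 0 -> rnorm p = 1.
Proof.
move=> sp pp p0; have := rnorm_star_cmul p; rewrite sp pp => h.
have /mulfI : rnorm p != 0 by apply/eqP => /rnorm_eq0.
by apply; rewrite mulr1 -expr2 -h.
Qed.

End CStarTheory.

(** * A C*-algebra as a Hilbert module over itself *)

Definition regular_module {R : realType} (A : cstarAlgType R) : Type := A.

Section RegularModule.
Context {R : realType} {A : cstarAlgType R}.

HB.instance Definition _ := CompleteNormedModule.copy (regular_module A) A.

Local Notation H := (regular_module A).
Let sinner (x y : H) : A := cmul (star (x : A)) y.

Fact regular_ge0 x : cpositive (sinner x x).
Proof. by exists x. Qed.

Fact regular_eq0 x : sinner x x = 0 -> x = 0.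
Proof. exact: star_cmul_eq0. Qed.

Fact regular_norm (x : H) : rnorm x = Num.sqrt (rnorm (sinner x x)).
Proof. by rewrite rnorm_star_cmul sqrtr_sqr ger0_norm // rnorm_ge0. Qed.

Fact regular_innerDr (x y z : H) :
  sinner x (y + z) = sinner x y + sinner x z.
Proof. exact: cmulDr. Qed.

Fact regular_innerZr (c : R[i]) (x y : H) :
  sinner x (c *: y) = c *: sinner x y.
Proof. exact: cmulZr. Qed.

Fact regular_inner_ract (x y : H) a :
  sinner x (cmul (y : A) a) = cmul (sinner x y) a.
Proof. exact: cmulA. Qed.

Fact regular_star_inner (x y : H) : star (sinner x y) = sinner y x.
Proof. by rewrite /sinner starM starK. Qed.

HB.instance Definition _ := @CompleteNormedModule_isHilbertModule.Build R A H
  cmul sinner cmulDl cmulDr cmulA cmulZl cmulZr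
  regular_innerDr regular_innerZr regular_inner_ract regular_star_inner
  regular_ge0 regular_eq0 regular_norm.

End RegularModule.

Section LeftMultiplication.
Context {R : realType} {A : cstarAlgType R}.
Implicit Types a b e : A.

Fact lmul_subproof a (x y : regular_module A) :
  inner (cmul a (x : A) : regular_module A) y
  = inner x (cmul (star a) (y : A) : regular_module A).
Proof. by rewrite /inner /= starM cmulA. Qed.

Definition lmul a : adjointable (regular_module A) :=
  Adjointable (lmul_subproof a).

(** The supremum is attained at the unit e.  The operator is only required to
    act as the left multiplication by a, so that the lemma applies to sums and
    adjoints of left multiplications. *)
Lemma opnorm_lmul {e a} {T : adjointable (regular_module A)} :
  (forall x, cmul x e = x) -> rnorm e = 1 ->
  (forall x : A, T x = cmul a x) -> opnorm T = rnorm a.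
Proof.
move=> xe e1 Ta; rewrite /opnorm; set S := (X in sup X).
have ub : ubound S (rnorm a).
  move=> _ [x /= x1 <-]; rewrite Ta (le_trans (rnorm_cmul_le _ _)) //.
  by rewrite ler_piMr // rnorm_ge0.
have mem : S (rnorm a).
  by exists (e : regular_module A); rewrite /= ?Ta ?xe // [rnorm _]e1.
by apply/eqP; rewrite eq_le ge_sup ?ub_le_sup //; exists (rnorm a).
Qed.

(** At x = e, the inner product <a x, x> = x^* a^* x is a^* itself. *)
Lemma numerical_radius_lmul {e} a :
  (forall x, cmul x e = x) -> rnorm e = 1 ->
  numerical_radius (lmul a) = rnorm a.
Proof.
move=> xe e1; rewrite /numerical_radius; set S := (X in sup X).
have ub : ubound S (rnorm a).
  move=> _ [x /= x1 <-]; rewrite (le_trans (rnorm_cmul_le _ _)) //.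
  rewrite rnorm_star [X in _ * X]x1 mulr1 (le_trans (rnorm_cmul_le _ _)) //.
  by rewrite [X in _ * X]x1 mulr1.
have mem : S (rnorm a).
  exists (e : regular_module A) => //=.
  by rewrite /inner /= !xe rnorm_star.
by apply/eqP; rewrite eq_le ge_sup ?ub_le_sup //; exists (rnorm a).
Qed.

End LeftMultiplication.

(** * An element of square zero with a a^* + a^* a = 1 *)

Section MatrixUnit.
Context {R : realType} {A : cstarAlgType R}.
Context {a e : A}.
Hypotheses (xe : forall x, cmul x e = x) (e0 : e <> 0).

(** A right unit is self-adjoint, because e^* = e^* e, so it is a projection. *)
Lemma rnorm_unit : rnorm e = 1.
Proof.
have : star (cmul (star e) e) = cmul (star e) e by rewrite starM starK.
by rewrite !xe starK => se; apply: rnorm_projection.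
Qed.

Hypotheses (aa : cmul a a = 0)
  (aae : cmul a (star a) + cmul (star a) a = e).

(** Multiplying a a^* + a^* a = e by a^* a kills one term on account of
    a a = 0, which shows that a^* a is a projection; it is nonzero, as a = 0
    would force e = 0. *)
Lemma rnorm_mxunit : rnorm a = 1.
Proof.
set p := cmul (star a) a.
have p1 : rnorm p = 1.
  apply: rnorm_projection; first by rewrite starM starK.
    rewrite -[RHS]xe -aae cmulDr [X in _ = X + _]cmulA.
    by rewrite -(cmulA (star a) a a) aa cmulr0 cmul0r add0r.
  by move=> /star_cmul_eq0 a0; apply: e0; rewrite -aae a0 cmul0r cmulr0 addr0.
move: p1; rewrite rnorm_star_cmul => /eqP.
by rewrite sqrp_eq1 ?rnorm_ge0 // => /eqP.
Qed.

(** This element b is self-adjoint, and b^2 = e since the terms with a a and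
    a^* a^* vanish; then |b|^2 = |b^* b| = |e| = 1. *)
Lemma rnorm_mxunit_herm (c : R[i]) : `|c| = 1 ->
  rnorm (c *: a + c^* *: star a) = 1.
Proof.
move=> c1; set b := _ + _.
have sb : star b = b by rewrite starD !starZ starK conjCK addrC.
have sa : cmul (star a) (star a) = 0 by rewrite -starM aa star0.
have bb : cmul b b = e.
  rewrite cmulDl !cmulDr !(cmulZl, cmulZr) aa sa !scaler0 add0r addr0.
  by rewrite !scalerA [_ * c]mulrC -normCK c1 expr1n !scale1r.
have := rnorm_star_cmul b; rewrite sb bb rnorm_unit => /esym/eqP.
by rewrite sqrp_eq1 ?rnorm_ge0 // => /eqP.
Qed.

Lemma opnorm_Re_mxunit (c : R[i]) : `|c| = 1 ->
  opnorm (opRe (opscale c (lmul a))) = 2^-1.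
Proof.
move=> c1; rewrite (@opnorm_lmul _ _ e (2^-1 *: (c *: a + c^* *: star a))) //.
- rewrite rnormZ rnorm_mxunit_herm // mulr1.
  have -> : 2^-1 = (2^-1)%:C :> R[i] by rewrite fmorphV rmorph_nat.
  by rewrite normc_real ?invr_ge0.
- exact: rnorm_unit.
by move=> x; rewrite /= cmulZl cmulDl !cmulZl.
Qed.

End MatrixUnit.

(** * The Euclidean norm of row vectors and the operator norm of matrices *)

HB.lock Definition l2norm {R : realType} {m : nat} (u : 'rV[R[i]]_m) : R :=
  complex.Re (sqrtC (dotmx u u)).

HB.lock Definition opmxnorm {R : realType} {m : nat} (a : 'M[R[i]]_m) : R :=
  sup [set l2norm (u *m a) | u in [set u | l2norm u <= 1]].

Section EuclideanNorm.
Local Open Scope sesquilinear_scope.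
Context {R : realType} {m : nat}.
Implicit Types u v : 'rV[R[i]]_m.

Lemma l2norm_ge0 u : 0 <= l2norm u.
Proof.
by rewrite l2norm.unlock; exact: le_Re (sqrt_dnorm_ge0 (@dotmx R[i] m) u).
Qed.

Lemma normc_sqrt_dotmx u : normc (sqrtC (dotmx u u)) = l2norm u.
Proof.
by rewrite l2norm.unlock; exact: Re_norm_ge0 (sqrt_dnorm_ge0 (@dotmx R[i] m) u).
Qed.

Lemma l2norm_sqr u : l2norm u ^+ 2 = complex.Re (dotmx u u).
Proof.
rewrite l2norm.unlock -[in RHS](sqrtCK (dotmx u u)) !expr2 Re_ge0M //.
by rewrite sqrt_dnorm_ge0.
Qed.

Lemma l2normD u v : l2norm (u + v) <= l2norm u + l2norm v.
Proof.
rewrite l2norm.unlock -raddfD le_Re //.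
by have [] := triangle_lerif (@dotmx R[i] m) u v.
Qed.

Lemma l2normZ (c : R[i]) u : l2norm (c *: u) = normc c * l2norm u.
Proof.
rewrite l2norm.unlock dnormZ sqrtCM ?nnegrE ?exprn_ge0 ?dnorm_ge0 //.
by rewrite sqrCK // Re_normM.
Qed.

Lemma l2norm0 : l2norm (0 : 'rV[R[i]]_m) = 0.
Proof.
by have := l2normZ 0 (0 : 'rV[R[i]]_m); rewrite scale0r normc0 mul0r.
Qed.

Lemma l2norm_eq0 u : l2norm u = 0 -> u = 0.
Proof.
move=> u0; apply/eqP; rewrite -(sqrt_dnorm_eq0 (@dotmx R[i] m)).
by apply/eqP/eq0_normc; rewrite [LHS]normc_sqrt_dotmx.
Qed.

Lemma l2norm_CauchySchwarz u v : normc (dotmx u v) <= l2norm u * l2norm v.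
Proof.
have [/le_Re + _] := CauchySchwarz_sqrt (@dotmx R[i] m) u v.
by rewrite l2norm.unlock Re_ge0M // sqrt_dnorm_ge0.
Qed.

Lemma normc_le_l2norm u j : normc (u 0 j) <= l2norm u.
Proof.
rewrite -ler_sqr ?nnegrE ?normc_ge0 ?l2norm_ge0 // l2norm_sqr.
have -> : normc (u 0 j) ^+ 2 = complex.Re (`|u 0 j| ^+ 2).
  by rewrite expr2 Re_normM.
apply: le_Re; rewrite dotmxE mxE (bigD1 j) //= !mxE normCK lerDl.
apply: sumr_ge0 => k _.
by rewrite !mxE mul_conjC_ge0.
Qed.

Lemma l2norm_delta j : l2norm (delta_mx 0 j : 'rV[R[i]]_m) = 1.
Proof.
by rewrite l2norm.unlock dotmxE -rowE !mxE !eqxx conjC1 sqrtC1.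
Qed.

Lemma l2norm_sum {I : Type} (r : seq I) (F : I -> 'rV[R[i]]_m) :
  l2norm (\sum_(i <- r) F i) <= \sum_(i <- r) l2norm (F i).
Proof.
elim/big_ind2 : _ => [|u x v y ux vy|//]; first by rewrite l2norm0.
exact: le_trans (l2normD _ _) (lerD ux vy).
Qed.

Lemma dotmx_mull a u v : dotmx (u *m a) v = dotmx u (v *m a ^t*).
Proof. by rewrite !dotmxE trmx_mul map_mxM trmxCK mulmxA. Qed.

End EuclideanNorm.

Section OperatorNorm.
Local Open Scope sesquilinear_scope.
Context {R : realType} {m : nat}.
Implicit Types (a b : 'M[R[i]]_m) (u v : 'rV[R[i]]_m).

Lemma l2norm_mul_rows a u :
  l2norm (u *m a) <= l2norm u * \sum_i l2norm (row i a).
Proof.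
rewrite mulmx_sum_row mulr_sumr; apply: le_trans (l2norm_sum _ _) _.
apply: ler_sum => i _; rewrite l2normZ.
exact: ler_wpM2r (l2norm_ge0 _) _ _ (normc_le_l2norm u i).
Qed.

Lemma opmxnorm_has_ubound a :
  has_ubound [set l2norm (u *m a) | u in [set u | l2norm u <= 1]].
Proof.
exists (\sum_i l2norm (row i a)) => _ [v /= v1 <-].
apply: le_trans (l2norm_mul_rows a v) _; rewrite ler_piMl // sumr_ge0 // => i _.
exact: l2norm_ge0.
Qed.

Lemma l2norm_mul a u : l2norm (u *m a) <= opmxnorm a * l2norm u.
Proof.
have [/l2norm_eq0->|u0] := eqVneq (l2norm u) 0.
  by rewrite mul0mx l2norm0 mulr0.
have {}u0 : 0 < l2norm u by rewrite lt_neqAle eq_sym u0 l2norm_ge0.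
have h : normc ((l2norm u)^-1)%:C = (l2norm u)^-1.
  by rewrite normc_real // invr_ge0 l2norm_ge0.
rewrite -ler_pdivrMr // mulrC opmxnorm.unlock.
apply: ub_le_sup; first exact: opmxnorm_has_ubound.
exists (((l2norm u)^-1)%:C *: u) => /=.
  by rewrite l2normZ h mulVf ?gt_eqF.
by rewrite -scalemxAl l2normZ h.
Qed.

Lemma opmxnorm_le a M : 0 <= M -> (forall u, l2norm (u *m a) <= M * l2norm u) ->
  opmxnorm a <= M.
Proof.
move=> M0 aM; rewrite opmxnorm.unlock; apply: ge_sup.
  by exists 0; exists 0; rewrite /= ?mul0mx l2norm0.
by move=> _ [u /= u1 <-]; apply: le_trans (aM u) _; rewrite ler_piMr.
Qed.

Lemma opmxnorm_ge0 a : 0 <= opmxnorm a.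
Proof.
rewrite opmxnorm.unlock; apply: ub_le_sup; first exact: opmxnorm_has_ubound.
by exists 0; rewrite /= ?mul0mx l2norm0.
Qed.

Lemma opmxnormD a b : opmxnorm (a + b) <= opmxnorm a + opmxnorm b.
Proof.
apply: opmxnorm_le => [|u]; first by rewrite addr_ge0 ?opmxnorm_ge0.
rewrite mulmxDr mulrDl; apply: le_trans (l2normD _ _) _.
exact: lerD (l2norm_mul a u) (l2norm_mul b u).
Qed.

Lemma opmxnormM a b : opmxnorm (a *m b) <= opmxnorm a * opmxnorm b.
Proof.
apply: opmxnorm_le => [|u]; first by rewrite mulr_ge0 ?opmxnorm_ge0.
rewrite mulmxA [opmxnorm a * _]mulrC -mulrA.
apply: le_trans (l2norm_mul b (u *m a)) _.
exact: ler_wpM2l (opmxnorm_ge0 b) _ _ (l2norm_mul a u).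
Qed.

Lemma opmxnormZ (c : R[i]) a : opmxnorm (c *: a) = normc c * opmxnorm a.
Proof.
have le (d : R[i]) b : opmxnorm (d *: b) <= normc d * opmxnorm b.
  apply: opmxnorm_le => [|u].
    by rewrite mulr_ge0 ?normc_ge0 ?opmxnorm_ge0.
  rewrite -scalemxAr l2normZ -mulrA.
  exact: ler_wpM2l (normc_ge0 d) _ _ (l2norm_mul b u).
(* The converse inequality is [le] for the scalar c^-1 and the matrix c *: a. *)
apply/eqP; rewrite eq_le le andTb.
have [->|c0] := eqVneq c 0; first by rewrite normc0 mul0r opmxnorm_ge0.
have := ler_wpM2l (normc_ge0 c) (le c^-1 (c *: a)).
by rewrite scalerA mulVf // scale1r mulrA -normcM divff // normc1 mul1r.
Qed.

Lemma normc_le_opmxnorm a i j : normc (a i j) <= opmxnorm a.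
Proof.
have := normc_le_l2norm (row i a) j; rewrite mxE => /le_trans; apply.
by have := l2norm_mul a (delta_mx 0 i); rewrite l2norm_delta mulr1 -rowE.
Qed.

Lemma opmxnorm_eq0 a : opmxnorm a = 0 -> a = 0.
Proof.
move=> a0; apply/matrixP => i j; rewrite mxE; apply/eq0_normc/eqP.
by rewrite eq_le normc_ge0 andbT -a0 normc_le_opmxnorm.
Qed.

Lemma opmxnorm_le_entries a : opmxnorm a <= \sum_i \sum_j normc (a i j).
Proof.
apply: opmxnorm_le => [|u].
  by do 2 (apply: sumr_ge0 => ? _); apply: normc_ge0.
apply: le_trans (l2norm_mul_rows a u) _.
rewrite mulrC; apply: ler_wpM2r; first exact: l2norm_ge0.
apply: ler_sum => i _; rewrite [row i a]row_sum_delta.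
apply: le_trans (l2norm_sum _ _) _; apply: ler_sum => j _.
by rewrite l2normZ l2norm_delta mulr1 mxE.
Qed.

(** |u a|^2 = <u a, u a> = <u, u a a^*> <= |u| |u a a^*| <= |a a^*| |u|^2. *)
Lemma opmxnorm_sqr_le a : opmxnorm a ^+ 2 <= opmxnorm (a *m a ^t*).
Proof.
rewrite -[leRHS]sqr_sqrtr ?opmxnorm_ge0 //.
rewrite ler_sqr ?nnegrE ?opmxnorm_ge0 ?sqrtr_ge0 //.
apply: opmxnorm_le => [|u]; first exact: sqrtr_ge0.
rewrite -ler_sqr ?nnegrE ?mulr_ge0 ?l2norm_ge0 ?sqrtr_ge0 //.
rewrite exprMn sqr_sqrtr ?opmxnorm_ge0 // [leLHS]l2norm_sqr.
rewrite -Re_norm_ge0 ?(dnorm_ge0 (@dotmx R[i] m)) // dotmx_mull -mulmxA.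
apply: le_trans (l2norm_CauchySchwarz _ _) _; rewrite mulrC expr2 mulrA.
exact: ler_wpM2r (l2norm_ge0 u) _ _ (l2norm_mul _ u).
Qed.

(** The C*-identity.  As with [rnorm_star], the inequality
    |x|^2 <= |x x^*| <= |x| |x^*| first gives |x| = |x^*|; with x = a^* it then
    gives |a|^2 <= |a^* a|, the other inequality being submultiplicativity. *)
Lemma opmxnorm_adj_mul a : opmxnorm (a ^t* *m a) = opmxnorm a ^+ 2.
Proof.
have le (x y : 'M[R[i]]_m) : x ^t* = y -> opmxnorm x <= opmxnorm y.
  move=> xy; have [/le_trans->//|x0] := lerP (opmxnorm x) 0.
    exact: opmxnorm_ge0.
  rewrite -(ler_pM2l x0).
  have := le_trans (opmxnorm_sqr_le x) (opmxnormM x (x ^t*)).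
  by rewrite expr2 xy.
have [b ab ba] : exists2 b, a ^t* = b & b ^t* = a.
  by exists (a ^t*) => //; exact: trmxCK.
have eq : opmxnorm b = opmxnorm a.
  by apply: le_anti; rewrite (le _ _ ab) (le _ _ ba).
rewrite ab; apply: le_anti; apply/andP; split.
  by have := opmxnormM b a; rewrite eq.
by have := opmxnorm_sqr_le b; rewrite eq ba.
Qed.

End OperatorNorm.

(** * The C*-algebra of complex square matrices *)

Section MatrixAlgebra.
Context {R : realType} {m : nat}.

(** A copy of the matrix type, as the matrix type itself carries the norm given
    by the largest entry. *)
Definition cmatrix : Type := 'M[R[i]]_m.

HB.instance Definition _ := GRing.Lmodule.copy cmatrix 'M[R[i]]_m.

Implicit Types a b : cmatrix.

Fact cmatrix_normD a b :
  (opmxnorm (a + b))%:C <= (opmxnorm a)%:C + (opmxnorm b)%:C.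
Proof. by rewrite -rmorphD lecR; apply: opmxnormD. Qed.

Fact cmatrix_normZ (c : R[i]) a :
  (opmxnorm (c *: a))%:C = `|c| * (opmxnorm a)%:C.
Proof. by rewrite [opmxnorm _]opmxnormZ (rmorphM (real_complex R)). Qed.

Fact cmatrix_norm_eq0 a : (opmxnorm a)%:C = 0 -> a = 0.
Proof. by move=> [/opmxnorm_eq0]. Qed.

HB.instance Definition _ := Lmodule_isNormed.Build R[i] cmatrix
  cmatrix_normD cmatrix_normZ cmatrix_norm_eq0.

Lemma rnorm_cmatrix a : rnorm a = opmxnorm a.
Proof. by []. Qed.

End MatrixAlgebra.
Arguments cmatrix : clear implicits.

(** A 1-Lipschitz real function maps Cauchy filters to Cauchy filters, and the
    reals are complete. *)
Lemma cauchy_image_cvg {R : realType} {V : normedModType R[i]}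
    (F : set_system V) (f : V -> R) :
  ProperFilter F -> cauchy F -> (forall x y, `|f x - f y| <= rnorm (x - y)) ->
  cvg (f @ F).
Proof.
move=> FF cF fle; apply: R_complete; apply/cauchyP => e e0.
have e0C : 0 < e%:C by rewrite ltcE /= eqxx.
have /cauchyP/(_ _ e0C)[x Fx] := cF.
exists (f x).
rewrite -[_ (ball _ _)]/(F (f @^-1` ball (f x) e)).
apply: filterS Fx => y.
rewrite -ball_normE => xy; have {xy} : `|x - y| < e%:C by [].
by rewrite rnormE ltcR; apply: le_lt_trans.
Qed.

(** Real and imaginary parts of entries are 1-Lipschitz for the operator norm,
    hence converge along F; conversely the operator norm is at most the sum of
    the moduli of the entries, so F converges to the matrix of the limits. *)
Lemma cmatrix_complete {R : realType} {m : nat} (F : set_system (cmatrix R m)) :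
  ProperFilter F -> cauchy F -> cvg F.
Proof.
move=> FF cF.
have entry_le (a b : cmatrix R m) i j : normc (a i j - b i j) <= rnorm (a - b).
  by have := normc_le_opmxnorm (a - b) i j; rewrite !mxE.
have cre i j : cvg ((fun a : cmatrix R m => complex.Re (a i j)) @ F).
  apply: cauchy_image_cvg => // a b; rewrite -raddfB.
  exact: le_trans (ReIm_le_normc _).1 (entry_le a b i j).
have cim i j : cvg ((fun a : cmatrix R m => complex.Im (a i j)) @ F).
  apply: cauchy_image_cvg => // a b; rewrite -raddfB.
  exact: le_trans (ReIm_le_normc _).2 (entry_le a b i j).
pose l : cmatrix R m := \matrix_(i, j)
  (lim ((fun a : cmatrix R m => complex.Re (a i j)) @ F) +i*
   lim ((fun a : cmatrix R m => complex.Im (a i j)) @ F)).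
apply/cvg_ex; exists l; apply/fcvgrPdist_lt => e e0.
have {e0} [d -> d0] : exists2 d : R, e = d%:C & 0 < d.
  case: e e0 => x y; rewrite ltcE /= => /andP[/eqP-> x0].
  by exists x.
(* s bounds the operator norm of any matrix all of whose entries have real and
   imaginary parts in [-1, 1]; adding 1 avoids a division by zero for m = 0. *)
pose s := \sum_(i < m) \sum_(j < m) (2 : R).
have s0 : 0 <= s by do 2 apply: sumr_ge0 => ? _.
pose h := d / (s + 1).
have h0 : 0 < h by rewrite divr_gt0 // ltr_wpDl.
have near_re i j : {near F, forall a : cmatrix R m,
    `|complex.Re (l i j) - complex.Re (a i j)| < h}.
  by rewrite mxE /=; exact: (@cvgr_dist_lt _ R^o _ _ _ _ _ (cre i j) _ h0).
have near_im i j : {near F, forall a : cmatrix R m,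
    `|complex.Im (l i j) - complex.Im (a i j)| < h}.
  by rewrite mxE /=; exact: (@cvgr_dist_lt _ R^o _ _ _ _ _ (cim i j) _ h0).
have near_all : {near F, forall a : cmatrix R m, forall i j,
    `|complex.Re (l i j) - complex.Re (a i j)| < h /\
    `|complex.Im (l i j) - complex.Im (a i j)| < h}.
  apply: filter_forall => i; apply: filter_forall => j.
  by apply: filterS2 (near_re i j) (near_im i j).
apply: filterS near_all => a la.
rewrite rnormE ltcR rnorm_cmatrix; apply: le_lt_trans (opmxnorm_le_entries _) _.
apply: (@le_lt_trans _ _ (s * h)); last first.
  by rewrite mulrA ltr_pdivrMr ?ltr_wpDl // mulrC mulrDr mulr1 ltrDl.
rewrite mulr_suml; apply: ler_sum => i _; rewrite mulr_suml.
apply: ler_sum => j _; have [/ltW re /ltW im] := la i j.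
have -> : (l - a) i j = l i j - a i j by rewrite !mxE.
apply: le_trans (normc_le_ReIm _) _.
by rewrite mulr_natl mulr2n !raddfB; exact: lerD re im.
Qed.

Section MatrixCStar.
Local Open Scope sesquilinear_scope.
Context {R : realType} {m : nat}.
Local Notation M := (cmatrix R m).

HB.instance Definition _ := Uniform_isComplete.Build M (@cmatrix_complete R m).

Let mul (a b : M) : M := a *m b.
Let adj (a : M) : M := a ^t*.

Fact cmatrix_mulA : associative mul. Proof. exact: mulmxA. Qed.
Fact cmatrix_mulDl : left_distributive mul +%R. Proof. exact: mulmxDl. Qed.
Fact cmatrix_mulDr : right_distributive mul +%R. Proof. exact: mulmxDr. Qed.
Fact cmatrix_mulZl (c : R[i]) (a b : M) : mul (c *: a) b = c *: mul a b.
Proof. by rewrite /mul scalemxAl. Qed.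
Fact cmatrix_mulZr (c : R[i]) (a b : M) : mul a (c *: b) = c *: mul a b.
Proof. by rewrite /mul scalemxAr. Qed.
Fact cmatrix_norm_mul (a b : M) : rnorm (mul a b) <= rnorm a * rnorm b.
Proof. exact: opmxnormM. Qed.
Fact cmatrix_adjK : involutive adj. Proof. by move=> a; exact: trmxCK. Qed.
Fact cmatrix_adjD : {morph adj : a b / a + b}.
Proof. by move=> a b; apply/matrixP => i j; rewrite !mxE rmorphD. Qed.
Fact cmatrix_adjZ (c : R[i]) (a : M) : adj (c *: a) = c^* *: adj a.
Proof. by apply/matrixP => i j; rewrite !mxE rmorphM. Qed.
Fact cmatrix_adjM (a b : M) : adj (mul a b) = mul (adj b) (adj a).
Proof. by rewrite /adj trmx_mul map_mxM. Qed.
Fact cmatrix_norm_adj_mul (a : M) : rnorm (mul (adj a) a) = rnorm a ^+ 2.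
Proof. exact: opmxnorm_adj_mul. Qed.

HB.instance Definition _ := @CompleteNormedModule_isCStarAlgebra.Build R M
  mul adj cmatrix_mulA cmatrix_mulDl cmatrix_mulDr cmatrix_mulZl cmatrix_mulZr
  cmatrix_norm_mul cmatrix_adjK cmatrix_adjD cmatrix_adjZ cmatrix_adjM
  cmatrix_norm_adj_mul.

End MatrixCStar.

(** * The counterexample *)

Lemma adj_delta_mx {R : realType} {m : nat} (i j : 'I_m) :
  star (delta_mx i j : cmatrix R m) = delta_mx j i.
Proof. by rewrite /star /= trmx_delta map_delta_mx. Qed.

Lemma normr_expi {R : realType} (t : R) : `|expi t| = 1.
Proof. by rewrite normcE /= cos2Dsin2 sqrtr1. Qed.

Theorem theorem3p10 (R : realType) :
  exists (A : cstarAlgType R) (H : hilbertModType A) (T1 T2 : adjointable H),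
    [/\ forall x : H, T1 (T1 x) = 0,
        numerical_radius T1 <> 2^-1 * opnorm T1 &
        sup [set opnorm (opRe (opscale (expi t) T2)) | t in `[0, 2 * pi]]
          < numerical_radius T2].
Proof.
pose a : cmatrix R 2 := delta_mx 0 1; pose e : cmatrix R 2 := 1%:M.
have xe x : cmul x e = x by exact: mulmx1.
have e0 : e <> 0 by move/matrixP/(_ 0 0)/eqP; rewrite !mxE oner_eq0.
have aa : cmul a a = 0 by rewrite /cmul /= mul_delta_mx_0.
have aae : cmul a (star a) + cmul (star a) a = e.
  rewrite adj_delta_mx /cmul /= !mul_delta_mx.
  rewrite /e mx1_sum_delta !big_ord_recl big_ord0 addr0.
  by congr (delta_mx _ _ + delta_mx _ _); apply: val_inj.
have e1 := rnorm_unit xe e0.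
have w1 : numerical_radius (lmul a) = 1.
  by rewrite (numerical_radius_lmul _ xe e1) (rnorm_mxunit xe e0 aa aae).
have n1 : opnorm (lmul a) = 1.
  by rewrite (opnorm_lmul xe e1 (a := a)) // (rnorm_mxunit xe e0 aa aae).
have Re_half := opnorm_Re_mxunit xe e0 aa aae.
exists (cmatrix R 2), (regular_module (cmatrix R 2)), (lmul a), (lmul a).
split.
- by move=> x; rewrite /= cmulA aa cmul0r.
- rewrite w1 n1 mulr1; lra.
rewrite w1 (_ : [set _ | _ in _] = [set 2^-1]) ?sup1; first lra.
apply/seteqP; split=> [_ [t _ <-]|_ ->] /=.
  exact: Re_half (normr_expi t).
exists 0; last exact: Re_half (normr_expi 0).
by rewrite /= in_itv /= lexx mulr_ge0 ?pi_ge0.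
Qed.
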